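(* For $p,q\in\mathbb Z_{\ge2}$, \begin{align*} &(1+(-1)^p)\zeta_2^\sharp(p,q)+(1+(-1)^q)\zeta_2^\sharp(q,p)\\ &=2\sum_{j=0}^{[p/2]}\frac{1}{2^{p+q-2j}}\binom{p+q-1-2j}{q-1}\zeta(2j)\zeta(p+q-2j)+2\sum_{j=0}^{[q/2]}\frac{1}{2^{p+q-2j}}\binom{p+q-1-2j}{p-1}\zeta(2j)\zeta(p+q-2j)-\zeta(p+q). \end{align*}
   Context: $\zeta_2^\sharp(s_1,s_2)=\sum_{m,n=1}^\infty n^{-s_1}(2m+n)^{-s_2}$; $\zeta$ is the Riemann zeta-function (so $\zeta(0)=-1/2$); $[x]$ is the integer part of $x$. *)

(* Defs.v *)
From HB Require Import structures.
From mathcomp Require Import all_boot all_order all_algebra.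
From mathcomp Require Import all_classical all_reals all_analysis.
Set Implicit Arguments. Unset Strict Implicit. Unset Printing Implicit Defensive.
Import Order.TTheory GRing.Theory Num.Theory.
Local Open Scope ring_scope.

(* Riemann zeta at nonnegative integer arguments, as needed in the paper:
   zeta 0 = -1/2 (value of the analytic continuation, as fixed in the paper's
   context), zeta s = \sum_{n>=1} n^{-s} for s >= 2.  (zeta 1 is junk and
   never used.) *)
Definition zeta (R : realType) (s : nat) : R :=
  if s == 0%N then - (2%:R)^-1
  else \big[+%R/0%R]_(1 <= n <oo) (n%:R ^- s : R).

(* zeta_2^sharp(s1,s2) = sum_{m,n>=1} n^{-s1} (2m+n)^{-s2}, for integer
   s1, s2 >= 2 (positive terms, absolutely convergent; written as an iterated
   series, which equals the double series). *)
Definition zeta2sharp (R : realType) (s1 s2 : nat) : R :=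
  \big[+%R/0%R]_(1 <= m <oo) \big[+%R/0%R]_(1 <= n <oo) ((n%:R ^- s1) * ((2 * m + n)%:R ^- s2) : R).

(* Main.v *)
Require Import Defs.
From HB Require Import structures.
From mathcomp Require Import all_boot all_order all_algebra.
From mathcomp Require Import all_classical all_reals all_analysis.
From mathcomp Require Import ring lra zify.
Set Implicit Arguments. Unset Strict Implicit. Unset Printing Implicit Defensive.
Import Order.TTheory GRing.Theory Num.Theory.
Import numFieldNormedType.Exports.
Local Open Scope classical_set_scope.
Local Open Scope ring_scope.

(* Fix c >= 1 and let S_c(p,q) be the sum of a^-p b^-q over nonzero integers a, b
   with a + b = c.  From c / (ab) = 1/a + 1/b one gets
   c S_c(p+1,q+1) = S_c(p,q+1) + S_c(p+1,q), and this Pascal recursion, started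
   from S_c(p,0) (an even zeta value, or 0 when p is odd, minus c^-p), evaluates
   S_c(p,q) as a sum of zeta(2j) c^-(p+q-2j) with binomial coefficients.  Truncation
   makes sense of the conditionally convergent cases p + q = 1.  Now take c = 2m and
   sum over m >= 1.  The pairs with a < 0 or b < 0 give (-1)^p zeta2sharp(p,q) and
   (-1)^q zeta2sharp(q,p).  The pairs with a, b > 0 give zeta(p+q) (a = b),
   zeta2sharp(p,q) (a < b) and zeta2sharp(q,p) (a > b), after regrouping a positive
   double series along antidiagonals. *)

(** * Series over n >= 1 and regrouping of positive double series *)

Definition sums_to (R : realType) (f : nat -> R) (l : R) : Prop :=
  (fun N => \sum_(1 <= n < N) f n) @ \oo --> l.

Section Sums.
Variable R : realType.
Implicit Types (f g F : nat -> R) (l : R).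

Lemma sums_to_unique f l1 l2 : sums_to f l1 -> sums_to f l2 -> l1 = l2.
Proof. exact: (@cvg_unique R). Qed.

Lemma eq_sums_to f g l :
  (forall n, (0 < n)%N -> f n = g n) -> sums_to f l -> sums_to g l.
Proof.
move=> fg; rewrite /sums_to; suff -> : (fun N => \sum_(1 <= n < N) f n) =
  (fun N => \sum_(1 <= n < N) g n) by [].
by apply/funext => N; apply: eq_big_nat => n /andP[n0 _]; exact: fg.
Qed.

Lemma sums_toD f g l1 l2 : sums_to f l1 -> sums_to g l2 ->
  sums_to (fun n => f n + g n) (l1 + l2).
Proof.
move=> fl gl; rewrite /sums_to; under eq_fun do rewrite big_split /=.
exact: cvgD.
Qed.

Lemma sums_toZ f l (a : R) : sums_to f l -> sums_to (fun n => a * f n) (a * l).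
Proof.
move=> fl; rewrite /sums_to; under eq_fun do rewrite -mulr_sumr.
by apply: cvgM => //; exact: cvg_cst.
Qed.

Lemma sums_to_sum (r : seq nat) (f : nat -> nat -> R) (l : nat -> R) :
  (forall i, i \in r -> sums_to (f i) (l i)) ->
  sums_to (fun n => \sum_(i <- r) f i n) (\sum_(i <- r) l i).
Proof.
elim: r => [|i r IH] fl.
  rewrite big_nil; apply: (@cvg_trans _ ((fun=> 0 : R) @ \oo)); last exact: cvg_cst.
  by apply: near_eq_cvg; apply: nearW => N; rewrite big1// => n _; rewrite big_nil.
rewrite big_cons; apply: eq_sums_to (sums_toD _ _) => [n _||].
- by rewrite big_cons.
- by apply: fl; rewrite inE eqxx.
- by apply: IH => j jr; apply: fl; rewrite inE jr orbT.
Qed.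

Lemma nondecreasing_psums f : (forall n, (0 < n)%N -> 0 <= f n) ->
  nondecreasing_seq (fun N => \sum_(1 <= n < N) f n).
Proof.
move=> f0; apply/nondecreasing_seqP => -[|N]; first by rewrite !big_geq.
by rewrite [leRHS]big_nat_recr//= lerDl f0.
Qed.

Lemma psums_le f l N : (forall n, (0 < n)%N -> 0 <= f n) -> sums_to f l ->
  \sum_(1 <= n < N) f n <= l.
Proof.
move=> f0 fl; rewrite -(cvg_lim _ fl)//.
by apply: (nondecreasing_cvgn_le (nondecreasing_psums f0)); apply/cvg_ex; exists l.
Qed.

Lemma sums_to_ge0 f l : (forall n, (0 < n)%N -> 0 <= f n) -> sums_to f l -> 0 <= l.
Proof. by move=> f0 fl; have := psums_le 0 f0 fl; rewrite big_geq. Qed.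

Lemma sums_to_le f l B : sums_to f l ->
  (forall N, \sum_(1 <= n < N) f n <= B) -> l <= B.
Proof.
by move=> fl fB; apply: (ler_cvg_to fl (cvg_cst B)); exact: nearW.
Qed.

(** The sum is written as a [limn] because the infinite sums in [zeta] and [zeta2sharp] unfold to
    this; the bound makes it a genuine limit. *)
Lemma bounded_sums_to f B : (forall n, (0 < n)%N -> 0 <= f n) ->
  (forall N, \sum_(1 <= n < N) f n <= B) ->
  sums_to f (limn (fun N => \sum_(1 <= n < N) f n)).
Proof.
move=> f0 fB; apply: nondecreasing_is_cvgn; first exact: nondecreasing_psums.
by exists B => _ [N _ <-].
Qed.

Lemma triangle_sum (f : nat -> nat -> R) M :
  \sum_(1 <= m < M) \sum_(1 <= k < m) f k (m - k)%N =
  \sum_(1 <= k < M) \sum_(1 <= n < M - k) f k n.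
Proof.
case: M => [|M]; first by rewrite !big_geq.
elim: M => [|M IH]; first by rewrite !big_geq.
rewrite [LHS]big_nat_recr//= IH [RHS]big_nat_recr//= subSnn [X in _ = _ + X]big_geq// addr0.
rewrite -big_split/=; apply: eq_big_nat => k /andP[k1 kM].
by rewrite (@subSn k M.+1) 1?ltnW// [RHS]big_nat_recr//= subn_gt0.
Qed.

(** Finite triangles are at most l, each row being at most its full sum. Conversely, for fixed K the
    rows k < K, cut off at n < M - k, lie inside the triangle of size M >= K; letting M and then K
    grow bounds l by the triangular sum. *)
Lemma sums_to_triangle (f : nat -> nat -> R) F l :
  (forall k n, (0 < k)%N -> (0 < n)%N -> 0 <= f k n) ->
  (forall k, (0 < k)%N -> sums_to (f k) (F k)) -> sums_to F l ->
  sums_to (fun m => \sum_(1 <= k < m) f k (m - k)%N) l.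
Proof.
move=> f0 fF Fl.
have F0 k : (0 < k)%N -> 0 <= F k.
  by move=> k0; apply: sums_to_ge0 (fF k k0) => n; exact: f0.
have g0 m : (0 < m)%N -> 0 <= \sum_(1 <= k < m) f k (m - k)%N.
  move=> m0; rewrite big_nat_cond sumr_ge0// => k; rewrite andbT => /andP[k0 km].
  by rewrite f0// subn_gt0.
have gl M : \sum_(1 <= m < M) \sum_(1 <= k < m) f k (m - k)%N <= l.
  rewrite triangle_sum; apply: le_trans (psums_le M F0 Fl).
  apply: ler_sum_nat => k /andP[k0 _]; apply: psums_le (fF k k0) => n; exact: f0.
have gd := bounded_sums_to g0 gl; set d := limn _ in gd.
suff <- : d = l by [].
apply/eqP; rewrite eq_le (sums_to_le gd gl)/=.
apply: (sums_to_le Fl) => K.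
have cK : (fun M => \sum_(1 <= k < K) \sum_(1 <= n < M - k) f k n) @ \oo
    --> \sum_(1 <= k < K) F k.
  rewrite big_nat_cond; under eq_fun do rewrite big_nat_cond.
  apply: cvg_big => [|k /andP[/andP[k0 _] _]]; first exact: add_continuous.
  rewrite (cvg_centern k (fun N => \sum_(1 <= n < N) f k n)); exact: fF.
apply: (ler_cvg_to cK gd); exists K => // M /= KM.
(* Splitting the range 1 <= k < M at K requires K >= 1, so K = 0 is treated apart. *)
rewrite triangle_sum; case: (posnP K) => [->|K0].
  rewrite [leLHS]big_geq// big_nat_cond sumr_ge0// => k; rewrite andbT => /andP[k0 _].
  by rewrite big_nat_cond sumr_ge0// => n; rewrite andbT => /andP[n0 _]; exact: f0.
rewrite [leRHS](@big_cat_nat _ _ _ K)//=.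
rewrite lerDl big_nat_cond sumr_ge0// => k; rewrite andbT => /andP[k0 _].
rewrite big_nat_cond sumr_ge0// => n; rewrite andbT => /andP[n0 _].
by rewrite f0// (leq_trans K0).
Qed.

End Sums.

(** * Zeta series, and truncated partial-fraction sums with their limits for q = 0 *)

Section Zeta.
Variable R : realType.

Lemma invX_ge0 (n s : nat) : 0 <= n%:R ^- s :> R.
Proof. by rewrite invr_ge0 exprn_ge0. Qed.

Lemma invNX (x : R) (s : nat) : (- x) ^- s = (-1) ^+ s * x ^- s.
Proof. by rewrite [in LHS]exprNn invfM -[in LHS]exprVn invrN1. Qed.

(** Telescoping, from (x + 1)^-2 <= 1/x - 1/(x + 1). The resulting bound 2 serves for all exponents
    s >= 2. *)
Lemma sum_inv_sqr_le (N : nat) :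
  \sum_(1 <= n < N.+2) n%:R ^- 2 <= 2 - N.+1%:R^-1 :> R.
Proof.
elim: N => [|N IH]; first by rewrite big_nat1 expr1n invr1; lra.
rewrite big_nat_recr//=; apply: (@le_trans _ _ (2 - N.+1%:R^-1 + N.+2%:R ^- 2)).
  by rewrite lerD2r.
rewrite -subr_ge0.
have -> : N.+2%:R = N.+1%:R + 1 :> R by rewrite -natr1.
have x0 : 0 < N.+1%:R :> R by rewrite ltr0n.
move: (N.+1%:R : R) x0 => x x0.
have -> : 2 - (x + 1)^-1 - (2 - x^-1 + (x + 1) ^- 2) = (x * (x + 1) ^+ 2)^-1.
  by field; rewrite !gt_eqF// addr_gt0.
by rewrite invr_ge0 mulr_ge0 ?exprn_ge0 ?ltW// addr_gt0.
Qed.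

Lemma sums_to_zeta (s : nat) : (2 <= s)%N ->
  sums_to (fun n => n%:R ^- s : R) (zeta R s).
Proof.
move=> s2; rewrite /zeta gtn_eqF 1?(leq_trans _ s2)//.
apply: (@bounded_sums_to _ _ 2) => [n _|]; first exact: invX_ge0.
case=> [|[|N]]; [by rewrite big_geq|by rewrite big_geq|].
apply: (@le_trans _ _ (2 - N.+1%:R^-1)); last by rewrite gerBl invr_ge0.
apply: le_trans (sum_inv_sqr_le N); apply: ler_sum_nat => n /andP[n0 _].
by rewrite lef_pV2 ?posrE ?exprn_gt0 ?ltr0n// ler_weXn2l// ler1n.
Qed.

(* With [x] running over the nonzero integers other than [c], these are the
   terms a^-p b^-q with a + b = c. *)
Definition pfterm (c : R) (p q : nat) (x : R) : R := x ^- p * (c - x) ^- q.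

Lemma pftermSS (c : R) p q x : x != 0 -> c - x != 0 ->
  c * pfterm c p.+1 q.+1 x = pfterm c p q.+1 x + pfterm c p.+1 q x.
Proof.
rewrite /pfterm; set y := c - x => x0 y0; have -> : c = x + y by rewrite addrC subrK.
have xp : x ^+ p != 0 by rewrite expf_neq0.
have yq : y ^+ q != 0 by rewrite expf_neq0.
by rewrite !exprS; field; rewrite x0 y0 xp yq.
Qed.

(** The window -N < x < c + N without 0 and c. It is stable under x -> c - x, which exchanges p and
    q, and leaving out 0 and c makes the recursion exact for every N. *)
Definition pfsum (c p q N : nat) : R :=
  \sum_(1 <= n < c) pfterm c%:R p q n%:R +
  \sum_(1 <= n < N) (pfterm c%:R p q (- n%:R) + pfterm c%:R p q (c + n)%:R).

Lemma pfsumSS c p q N :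
  c%:R * pfsum c p.+1 q.+1 N = pfsum c p q.+1 N + pfsum c p.+1 q N.
Proof.
have neq0 n : (0 < n)%N -> n%:R != 0 :> R by rewrite pnatr_eq0 -lt0n.
have nn n : (0 < n)%N -> - n%:R != 0 :> R by move/neq0; rewrite oppr_eq0.
rewrite /pfsum mulrDr addrACA -!big_split/= !mulr_sumr; congr (_ + _).
  apply: eq_big_nat => n /andP[n0 nc].
  by rewrite pftermSS ?neq0// -natrB ?neq0 ?subn_gt0// ltnW.
apply: eq_big_nat => n /andP[n0 _]; rewrite mulrDr !pftermSS ?nn ?neq0//.
- by rewrite addrACA.
- by rewrite addn_gt0 n0 orbT.
- by rewrite natrD opprD addNKr nn.
- by rewrite opprK -natrD neq0// addn_gt0 n0 orbT.
Qed.

Lemma pfsumC c p q N : pfsum c p q N = pfsum c q p N.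
Proof.
rewrite /pfsum; congr (_ + _).
  rewrite big_nat_rev/=; apply: eq_big_nat => n /andP[n0 nc].
  rewrite add1n subSS /pfterm natrB 1?ltnW// mulrC; congr (_ ^- _ * _ ^- _).
  by rewrite opprB addrC subrK.
apply: eq_big_nat => n _; rewrite addrC /pfterm natrD opprK opprD addNKr.
by congr (_ + _); exact: mulrC.
Qed.

(** The positive points fill 1 <= n < N + c except n = c, whence the subtracted term; N > 0 places c
    in that range. *)
Lemma pfsum0 c p N : (0 < c)%N -> (0 < N)%N -> pfsum c p 0 N =
  \sum_(1 <= n < N + c) n%:R ^- p + (-1) ^+ p * \sum_(1 <= n < N) n%:R ^- p - c%:R ^- p.
Proof.
move=> c0 N0; rewrite /pfsum /pfterm.
under eq_bigr do rewrite expr0 invr1 mulr1.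
under [X in _ + X]eq_bigr do rewrite !expr0 invr1 !mulr1.
rewrite (@big_cat_nat _ _ _ c.+1 1 (N + c))//=; last first.
  by rewrite -[c.+1]add1n leq_add2r.
rewrite big_nat_recr//= big_split/=.
have -> : \sum_(c.+1 <= n < N + c) n%:R ^- p = \sum_(1 <= n < N) (c + n)%:R ^- p :> R.
  by rewrite -add1n big_addn addnK; apply: eq_bigr => n _; rewrite addnC.
under [X in _ + (X + _)]eq_bigr do rewrite invNX.
rewrite -mulr_sumr; ring.
Qed.

(* The value of the symmetrically summed series of x^-i over the nonzero integers x,
   for [i > 0]. *)
Definition twozeta (i : nat) : R := if odd i then 0 else 2 * zeta R i.

Lemma cvg_pfsum0 c p : (0 < c)%N -> (0 < p)%N ->
  pfsum c p 0 N @[N --> \oo] --> twozeta p - c%:R ^- p.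
Proof.
move=> c0 p0; rewrite -cvg_shiftS/=; under eq_fun do rewrite pfsum0//.
apply: cvgB; last exact: cvg_cst.
rewrite /twozeta; case: ifPn => p_odd; last first.
  have p2 : (2 <= p)%N by case: p p0 p_odd => [|[|]].
  have zp := sums_to_zeta p2.
  under eq_fun do rewrite -signr_odd (negbTE p_odd) expr0 mul1r.
  rewrite mulr2n mulrDl mul1r; apply: cvgD.
    rewrite (cvg_shiftS (fun N => \sum_(1 <= n < N + c) n%:R ^- p : R)).
    by rewrite (cvg_shiftn c (fun N => \sum_(1 <= n < N) n%:R ^- p : R)).
  by rewrite (cvg_shiftS (fun N => \sum_(1 <= n < N) n%:R ^- p : R)).
(* For odd p the negative points cancel the positive ones up to N. What remains is c consecutive
   terms from N + 1 on, each tending to 0, even when p = 1. *)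
have E N : \sum_(1 <= n < N.+1 + c) n%:R ^- p + (-1) ^+ p * \sum_(1 <= n < N.+1) n%:R ^- p
    = \sum_(0 <= k < c) (k + N.+1)%:R^-1 ^+ p :> R.
  rewrite -signr_odd p_odd expr1 mulN1r.
  rewrite (@big_cat_nat _ _ _ N.+1 1 (N.+1 + c))//=; last by rewrite leq_addr.
  rewrite addrAC subrr add0r -{1}[N.+1]add0n big_addn addKn.
  by apply: eq_bigr => k _; rewrite exprVn.
rewrite (eq_cvg _ _ E).
suff : \sum_(0 <= k < c) (k + N.+1)%:R^-1 ^+ p @[N --> \oo] --> \sum_(0 <= k < c) (0 : R).
  by rewrite big1_eq.
apply: cvg_big => [|k _]; first exact: add_continuous.
suff : (k + N.+1)%:R^-1 ^+ p @[N --> \oo] --> (0 : R) ^+ p by rewrite expr0n gtn_eqF.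
apply: (@cvg_comp _ _ _ _ (fun x : R => x ^+ p)); last exact: exprn_continuous.
have E2 N : (k + N.+1)%:R^-1 = harmonic (N + k) :> R by rewrite /= addnS addnC.
by rewrite (eq_cvg _ _ E2) (cvg_shiftn k (@harmonic R)); exact: cvg_harmonic.
Qed.

End Zeta.

(** * Closed form of the limits, and its sum over c = 2m *)

Section Closed.
Variable R : realType.

(* [zeta R 0 = - 1/2] makes the terms [i = 0] account for the excluded points 0 and c. *)
Definition halflimit (c p q : nat) : R :=
  \sum_(0 <= i < p.+1) twozeta R i * 'C(p + q - 1 - i, p - i)%:R * c%:R ^- (p + q - i).

Lemma halflimit0r c p : (0 < p)%N -> halflimit c p 0 = twozeta R p.
Proof.
(* Below the top index the binomial has its lower entry one above its upper entry and vanishes; only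
   the top term survives. *)
case: p => // p _; rewrite /halflimit big_nat_recr//= big_nat_cond big1 => [|i]; last first.
  by move=> /andP[/andP[_ ip] _]; rewrite bin_small ?mulr0 ?mul0r//; lia.
by rewrite addn0 !subnn bin0 expr0 invr1 add0r !mulr1.
Qed.

Lemma halflimit0l c q : halflimit c 0 q = - c%:R ^- q.
Proof.
rewrite /halflimit big_nat1 add0n !subn0 bin0 mulr1 /twozeta/= /zeta/=.
by rewrite mulrN divff ?mulN1r// pnatr_eq0.
Qed.

(** Pascal's rule term by term for i <= p. The term i = p + 1 occurs only in the sums with [p.+1],
    with binomial coefficient 1. *)
Lemma halflimitSS c p q : (0 < c)%N ->
  c%:R * halflimit c p.+1 q.+1 = halflimit c p q.+1 + halflimit c p.+1 q.
Proof.
move=> c0; have cN0 : c%:R != 0 :> R by rewrite pnatr_eq0 -lt0n.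
have cV n : c%:R * c%:R ^- n.+1 = c%:R ^- n :> R by rewrite exprS invfM mulVKf.
rewrite /halflimit [X in _ * X]big_nat_recr//= [X in _ = _ + X]big_nat_recr//=.
rewrite addrA -big_split/= mulrDr mulr_sumr; congr (_ + _).
  apply: eq_big_nat => i /andP[_ ip].
  have -> : (p.+1 + q.+1 - 1 - i = (p + q - i).+1)%N by lia.
  have -> : (p.+1 - i = (p - i).+1)%N by lia.
  have -> : (p + q.+1 - 1 - i = p + q - i)%N by lia.
  have -> : (p.+1 + q - 1 - i = p + q - i)%N by lia.
  have -> : (p.+1 + q.+1 - i = (p + q - i).+2)%N by lia.
  have -> : (p + q.+1 - i = (p + q - i).+1)%N by lia.
  have -> : (p.+1 + q - i = (p + q - i).+1)%N by lia.
  rewrite binS natrD -(cV (p + q - i).+1); ring.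
rewrite subnn !bin0 !mulr1 -addSnnS.
have -> : (p.+2 + q - p.+1 = (p.+1 + q - p.+1).+1)%N by lia.
by rewrite mulrCA cV.
Qed.

(** Both sides obey the same recursion, so a nested induction leads down to p = 0 or q = 0. At p = q
    = 0 the truncated sum would merely count points; the recursion never reaches that case. *)
Lemma cvg_pfsum c p q : (0 < c)%N -> (0 < p + q)%N ->
  pfsum R c p q N @[N --> \oo] --> halflimit c p q + halflimit c q p.
Proof.
move=> c0; elim: p q => [|p IHp] q.
  move=> q0; under eq_fun do rewrite pfsumC.
  by rewrite halflimit0l halflimit0r// addrC; exact: cvg_pfsum0.
elim: q => [|q IHq] _.
  by rewrite halflimit0l halflimit0r//; exact: cvg_pfsum0.
have cN0 : c%:R != 0 :> R by rewrite pnatr_eq0 -lt0n.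
have E N : pfsum R c p.+1 q.+1 N =
    c%:R^-1 * (pfsum R c p q.+1 N + pfsum R c p.+1 q N).
  by rewrite -pfsumSS mulKf.
have -> : halflimit c p.+1 q.+1 + halflimit c q.+1 p.+1 = c%:R^-1 *
    ((halflimit c p q.+1 + halflimit c q.+1 p) + (halflimit c p.+1 q + halflimit c q p.+1)).
  apply: (mulfI cN0); rewrite mulVKf// mulrDr !halflimitSS//; ring.
rewrite (eq_cvg _ _ E); apply: cvgM; first exact: cvg_cst.
by apply: cvgD; [apply: IHp; rewrite addnS | exact: IHq].
Qed.

Lemma sum_even (g : nat -> R) p :
  \sum_(0 <= i < p.+1) (if odd i then 0 else g i) = \sum_(0 <= j < (p./2).+1) g (2 * j)%N.
Proof.
elim: p => [|p IH]; first by rewrite !big_nat1.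
rewrite big_nat_recr//= IH uphalf_half; case: (boolP (odd p)) => podd /=.
  rewrite add1n [RHS]big_nat_recr//=; congr (_ + g _).
  by rewrite -[in LHS](odd_double_half p) podd mul2n doubleS.
by rewrite addr0.
Qed.

(** As i <= p and q >= 2, every exponent p + q - i is at least 2, so the finitely many powers of 2m
    are summed over m separately. *)
Lemma sums_to_halflimit p q : (2 <= q)%N ->
  sums_to (fun m => halflimit (2 * m) p q)
    (2 * \sum_(0 <= j < (p./2).+1) 2%:R ^- (p + q - 2 * j) *
       'C(p + q - 1 - 2 * j, q - 1)%:R * zeta R (2 * j) * zeta R (p + q - 2 * j)).
Proof.
move=> q2.
have -> : 2 * (\sum_(0 <= j < (p./2).+1) 2%:R ^- (p + q - 2 * j) *
       'C(p + q - 1 - 2 * j, q - 1)%:R * zeta R (2 * j) * zeta R (p + q - 2 * j)) =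
    \sum_(0 <= i < p.+1) twozeta R i * 'C(p + q - 1 - i, p - i)%:R *
       2%:R ^- (p + q - i) * zeta R (p + q - i).
  under [RHS]eq_bigr => i _.
    rewrite (_ : _ * _ = if odd i then 0 else 2 * zeta R i * 'C(p + q - 1 - i, p - i)%:R *
       2%:R ^- (p + q - i) * zeta R (p + q - i)); last first.
      by rewrite /twozeta; case: ifP; rewrite ?mul0r.
    over.
  rewrite sum_even mulr_sumr; apply: eq_big_nat => j /andP[_ jp].
  have jp2 : (2 * j <= p)%N by lia.
  (* Symmetry of the binomial trades the lower entry q - 1 for p - 2j. *)
  rewrite -bin_sub; last by lia.
  have -> : (p + q - 1 - 2 * j - (q - 1) = p - 2 * j)%N by lia.
  ring.
apply: sums_to_sum => i; rewrite mem_index_iota => /andP[_ ip].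
have z : sums_to (fun n => n%:R ^- (p + q - i) : R) (zeta R (p + q - i)).
  by apply: sums_to_zeta; lia.
apply: eq_sums_to (sums_toZ z) => n _ /=.
by rewrite natrM exprMn invfM; ring.
Qed.

End Closed.

(** * The double series, and the decomposition of the limits by signs *)

Section Double.
Variable R : realType.

Definition shift_sum (s1 s2 c : nat) : R :=
  \big[+%R/0%R]_(1 <= n <oo) ((n%:R ^- s1) * ((c + n)%:R ^- s2) : R).

Definition antidiag_sum (p q c : nat) : R :=
  \sum_(1 <= n < c) n%:R ^- p * (c - n)%:R ^- q.

Lemma shift_term_le (s1 s2 c n : nat) : (0 < c)%N ->
  n%:R ^- s1 * (c + n)%:R ^- s2 <= c%:R ^- s2 * n%:R ^- s1 :> R.
Proof.
move=> c0; rewrite mulrC ler_wpM2r ?invX_ge0//.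
rewrite lef_pV2 ?posrE ?exprn_gt0 ?ltr0n ?addn_gt0 ?c0//.
by rewrite lerXn2r ?nnegrE// ler_nat leq_addr.
Qed.

Lemma shift_psum_le s1 s2 c N : (2 <= s1)%N -> (0 < c)%N ->
  \sum_(1 <= n < N) n%:R ^- s1 * (c + n)%:R ^- s2 <= c%:R ^- s2 * zeta R s1.
Proof.
move=> s12 c0; apply: (@le_trans _ _ (\sum_(1 <= n < N) c%:R ^- s2 * n%:R ^- s1)).
  by apply: ler_sum_nat => n _; exact: shift_term_le.
rewrite -mulr_sumr ler_wpM2l ?invX_ge0//.
by apply: (psums_le _ _ (sums_to_zeta s12)) => n _; exact: invX_ge0.
Qed.

Lemma sums_to_shift_sum s1 s2 c : (2 <= s1)%N -> (0 < c)%N ->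
  sums_to (fun n => n%:R ^- s1 * (c + n)%:R ^- s2) (shift_sum s1 s2 c).
Proof.
move=> s12 c0; apply: bounded_sums_to => [n _|N]; first by rewrite mulr_ge0 ?invX_ge0.
exact: shift_psum_le.
Qed.

Lemma shift_ge0 s1 s2 c : (2 <= s1)%N -> (0 < c)%N -> 0 <= shift_sum s1 s2 c.
Proof.
move=> s12 c0; apply: (sums_to_ge0 _ (sums_to_shift_sum s12 c0)) => n _.
by rewrite mulr_ge0 ?invX_ge0.
Qed.

(** Domination by a product of two zeta values, from (2m + n)^-s2 <= (2m)^-s2 <= m^-s2. *)
Lemma sums_to_zeta2sharp s1 s2 : (2 <= s1)%N -> (2 <= s2)%N ->
  sums_to (fun m => shift_sum s1 s2 (2 * m)) (zeta2sharp R s1 s2).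
Proof.
move=> s12 s22; apply: (@bounded_sums_to _ _ (zeta R s1 * zeta R s2)) => [m m0|M].
  by apply: shift_ge0; rewrite ?muln_gt0.
have z0 s : (2 <= s)%N -> 0 <= zeta R s.
  by move=> s_ge2; apply: (sums_to_ge0 _ (sums_to_zeta s_ge2)) => n _; exact: invX_ge0.
apply: (@le_trans _ _ (\sum_(1 <= m < M) zeta R s1 * m%:R ^- s2)); last first.
  rewrite -mulr_sumr ler_wpM2l ?z0//.
  by apply: (psums_le _ _ (sums_to_zeta s22)) => n _; exact: invX_ge0.
apply: ler_sum_nat => m /andP[m0 _].
have m20 : (0 < 2 * m)%N by rewrite muln_gt0.
apply: (@le_trans _ _ ((2 * m)%:R ^- s2 * zeta R s1)).
  by apply: (sums_to_le (sums_to_shift_sum s12 m20)) => N; exact: shift_psum_le.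
rewrite mulrC ler_wpM2l ?z0// lef_pV2 ?posrE ?exprn_gt0 ?ltr0n//.
by rewrite lerXn2r ?nnegrE// ler_nat leq_pmull.
Qed.

(** Two evaluations of the limit of [pfsum]. The points 0 < x < c give [antidiag_sum]; x = -n brings
    the sign (-1)^p, and x = c + n brings (-1)^q because c - x = -n. *)
Lemma antidiag_shift_identity p q c : (2 <= p)%N -> (2 <= q)%N -> (0 < c)%N ->
  antidiag_sum p q c + (-1) ^+ p * shift_sum p q c + (-1) ^+ q * shift_sum q p c =
  halflimit R c p q + halflimit R c q p.
Proof.
move=> p2 q2 c0; have pq0 : (0 < p + q)%N by rewrite addn_gt0 (leq_trans _ p2).
have E N : pfsum R c p q N = antidiag_sum p q c
    + (-1) ^+ p * (\sum_(1 <= n < N) n%:R ^- p * (c + n)%:R ^- q)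
    + (-1) ^+ q * (\sum_(1 <= n < N) n%:R ^- q * (c + n)%:R ^- p).
  rewrite /pfsum /pfterm -addrA; congr (_ + _).
    by apply: eq_big_nat => n /andP[n0 nc]; rewrite -natrB// ltnW.
  rewrite !mulr_sumr -big_split/=; apply: eq_bigr => n _.
  rewrite opprK -natrD natrD opprD addNKr -natrD !invNX; ring.
have lim := cvg_pfsum (R := R) c0 pq0; rewrite (eq_cvg _ _ E) in lim.
apply: (cvg_unique (@norm_hausdorff _ R) _ lim).
by apply: cvgD; [apply: cvgD; [exact: cvg_cst|]|]; apply: cvgM;
  (exact: cvg_cst || exact: sums_to_shift_sum).
Qed.

(** The entries of a pair with sum 2m are m - k and m + k up to order. Writing m + k as 2k + (m - k)
    exposes the [zeta2sharp] term at (k, n) with k + n = m. *)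
Lemma antidiag_sum_double p q m : (0 < m)%N -> antidiag_sum p q (2 * m) = m%:R ^- (p + q)
  + \sum_(1 <= k < m) (m - k)%:R ^- p * (2 * k + (m - k))%:R ^- q
  + \sum_(1 <= k < m) (m - k)%:R ^- q * (2 * k + (m - k))%:R ^- p.
Proof.
move=> m0; rewrite /antidiag_sum (@big_cat_nat _ _ _ m)//=; last by rewrite leq_pmull.
rewrite [X in _ + X]big_ltn; last by lia.
(* The half n < m is reflected by k = m - n, the half n > m shifted by k = n - m. *)
rewrite big_nat_rev/= -[m.+1]add1n big_addn.
have -> : (2 * m - m = m)%N by lia.
rewrite exprD invfM addrCA addrA; congr (_ + _ + _).
  apply: eq_big_nat => k km; congr (_ ^- _ * _ ^- _); congr (_%:R); lia.
apply: eq_big_nat => k km; rewrite mulrC; congr (_ ^- _ * _ ^- _); congr (_%:R); lia.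
Qed.

Lemma sums_to_antidiag_sum p q : (2 <= p)%N -> (2 <= q)%N ->
  sums_to (fun m => antidiag_sum p q (2 * m))
    (zeta R (p + q) + zeta2sharp R p q + zeta2sharp R q p).
Proof.
move=> p2 q2.
have T s1 s2 : (2 <= s1)%N -> (2 <= s2)%N ->
    sums_to (fun m => \sum_(1 <= k < m) (m - k)%:R ^- s1 * (2 * k + (m - k))%:R ^- s2)
      (zeta2sharp R s1 s2).
  move=> s12 s22.
  apply: (sums_to_triangle (f := fun k n => n%:R ^- s1 * (2 * k + n)%:R ^- s2)
    (F := fun k => shift_sum s1 s2 (2 * k))) => [k n _ _|k k0|].
  - by rewrite mulr_ge0 ?invX_ge0.
  - by apply: sums_to_shift_sum; rewrite ?muln_gt0.
  - exact: sums_to_zeta2sharp.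
have zpq : (2 <= p + q)%N by rewrite (leq_trans p2)// leq_addr.
apply: eq_sums_to (sums_toD (sums_toD (sums_to_zeta zpq) (T p q p2 q2)) (T q p q2 p2)).
by move=> m m0; rewrite antidiag_sum_double.
Qed.

End Double.

Theorem theorem6p4 (R : realType) (p q : nat) (hp : (2 <= p)%N) (hq : (2 <= q)%N) :
  (1 + (-1) ^+ p) * zeta2sharp R p q + (1 + (-1) ^+ q) * zeta2sharp R q p =
  2 * (\sum_(0 <= j < (p./2).+1)
         (2%:R ^- (p + q - 2 * j)) * ('C(p + q - 1 - 2 * j, q - 1))%:R
           * zeta R (2 * j) * zeta R (p + q - 2 * j))
  + 2 * (\sum_(0 <= j < (q./2).+1)
         (2%:R ^- (p + q - 2 * j)) * ('C(p + q - 1 - 2 * j, p - 1))%:R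
           * zeta R (2 * j) * zeta R (p + q - 2 * j))
  - zeta R (p + q).
Proof.
(* One series in m is summed twice, here by signs and in [rhs] by the closed form; equating the sums
   and moving zeta(p + q) across gives the claim. *)
have lhs : sums_to (fun m => halflimit R (2 * m) p q + halflimit R (2 * m) q p)
    (zeta R (p + q) + zeta2sharp R p q + zeta2sharp R q p
     + (-1) ^+ p * zeta2sharp R p q + (-1) ^+ q * zeta2sharp R q p).
  apply: eq_sums_to (sums_toD (sums_toD (sums_to_antidiag_sum hp hq)
    (sums_toZ (sums_to_zeta2sharp hp hq))) (sums_toZ (sums_to_zeta2sharp hq hp))).
  by move=> m m0; rewrite antidiag_shift_identity// muln_gt0.
have rhs := sums_toD (sums_to_halflimit (R := R) (p := p) hq)
  (sums_to_halflimit (R := R) (p := q) hp).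
rewrite [(q + p)%N]addnC in rhs.
by rewrite -(sums_to_unique lhs rhs); ring.
Qed.
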